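(* Let $\phi:\mathbb Z^2\to\mathbb C$ be a discrete holomorphic function with edge-labelling $(m_{ij})$, let $\mu\in\{1,-1,0\}$, and assume $1+\mu|\phi|^2\ne0$ at all vertices. Put $$\mathfrak p=\tfrac12(1+\mu)e_0+\tfrac12(1-\mu)e_3,\qquad G=\Big\langle\begin{pmatrix}|\phi|^2&\phi\\ \overline\phi&1\end{pmatrix}\Big\rangle:\mathbb Z^2\to\mathbb P\mathcal L .$$ Then the Weierstrass-type formula $$dx_{ij}=\operatorname{Re}\Big\{\tfrac{1}{m_{ij}(\phi_i-\phi_j)}\Big(\tfrac{1-\mu}2(\phi_i+\phi_j)e_0+(1-\mu\phi_i\phi_j)e_1+\mathrm i(1+\mu\phi_i\phi_j)e_2+\tfrac{1+\mu}2(\phi_i+\phi_j)e_3\Big)\Big\}$$ can be integrated to a discrete surface $x:\mathbb Z^2\to\mathbb R^{3,1}$ (unique up to translation) with values in an affine hyperplane with normal $\mathfrak p$. The map $L=x+G$ is a discrete Legendre immersion that is $\Omega$-dual to the prescribed discrete lightlike Gauss map $G$: $x$ is Christoffel dual to the section $g^n$ of $G$ with $(g^n,\mathfrak p)=-1$. Moreover $x$ (up to translation) is - a discrete minimal surface in Euclidean $3$-space $\langle e_0\rangle^\perp$ if $\mu=1$, - a discrete maximal surface in Lorentzian $3$-space $\langle e_3\rangle^\perp$ if $\mu=-1$, - a discrete i-minimal surface in isotropic $3$-space if $\mu=0$. That is, the Weierstrass-type representations of these three surface classes are applications of the $\Omega$-dual transformation to a prescribed discrete lightlike Gauss map.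
   Context: **Minkowski space.** $\mathbb R^{3,1}$ is the real vector space with basis $e_0,e_1,e_2,e_3$ and product $(e_0,e_0)=-1$, $(e_n,e_n)=1$ ($n=1,2,3$), $(e_n,e_{n'})=0$ for $n\ne n'$. $\mathcal L=\{v:(v,v)=0\}$; $\mathbb P\mathcal L$ is the set of one-dimensional null subspaces; $\langle\cdot\rangle$ denotes linear span. In the Hermitian model $\mathbb R^{3,1}$ is the space of Hermitian $2\times2$ matrices with $(v,v)=-\det v$, where $e_0=\begin{pmatrix}1&0\\0&1\end{pmatrix}$, $e_1=\begin{pmatrix}0&1\\1&0\end{pmatrix}$, $e_2=\begin{pmatrix}0&\mathrm i\\-\mathrm i&0\end{pmatrix}$, $e_3=\begin{pmatrix}1&0\\0&-1\end{pmatrix}$. **Discrete holomorphic.** $(ijkl)$ denotes an elementary quadrilateral (face) of $\mathbb Z^2$ with vertices in cyclic order. $\phi:\mathbb Z^2\to\mathbb C$ is discrete holomorphic if there is a real nowhere zero edge function $m_{ij}=m_{ji}$, equal on opposite edges of each face ($m_{ij}=m_{lk}$, $m_{il}=m_{jk}$), with $\frac{\phi_i-\phi_j}{\phi_j-\phi_k}\frac{\phi_k-\phi_l}{\phi_l-\phi_i}=\frac{m_{il}}{m_{ij}}<0$ on each face. **Discrete surfaces.** A discrete surface is a map $x:\mathbb Z^2\to\mathbb R^{3,1}$; $dx_{ij}=x_i-x_j$ on edges, $\delta x_{ik}=x_i-x_k$ on diagonals. In the formula, $\operatorname{Re}$ is applied to each coefficient of $e_0,\dots,e_3$. A discrete surface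 is planar if each face is mapped to coplanar points, and circular if it is planar and for each face there is $c\in\mathbb R^{3,1}$ with $(x-c,x-c)$ equal at its four vertices. Two discrete surfaces $x,y$ are edge-parallel if $dx_{ij},dy_{ij}$ are parallel on every edge; for these the mixed area is $A(x,y)_{ijkl}=\frac14(\delta x_{ik}\wedge\delta y_{jl}-\delta x_{jl}\wedge\delta y_{ik})\in\Lambda^2\mathbb R^{3,1}$. Standing assumption: discrete surfaces for which curvatures are considered satisfy $A(x,x)\neq0$ on every face. A discrete Legendre immersion is a map $L$ from $\mathbb Z^2$ to the affine null lines of $\mathbb R^{3,1}$ with $L_i\cap L_j\ne\emptyset$ for every edge; it has the form $L=x+G$ with $x_i\in L_i$ and lightlike Gauss map $G:\mathbb Z^2\to\mathbb P\mathcal L$. Sections of $L$, $G$: maps $y$ with $y_i\in L_i$, resp. nowhere zero $g$ with $\langle g_i\rangle=G_i$. **$\Omega$-duality.** Two discrete surfaces are Christoffel dual if they are edge-parallel, circular, and have vanishing mixed area. A Legendre immersion $L$ with lightlike Gauss map $G$ is $\Omega$-dual to $G$ (equivalently: $L$ is discrete L-isothermic) if there are sections $y$ of $L$ and $g$ of $G$ which are Christoffel dual. **Zero mean curvature.** For a circular surface $f$ in $\langle\mathfrak p\rangle^\perp$ with $(\mathfrak p,\mathfrak p)=-1$ (Euclidean $3$-space), resp. $(\mathfrak p,\mathfrak p)=1$ (Lorentzian $3$-space), and an edge-parallel Gauss map $n$ in $\langle\mathfrak p\rangle^\perp$ with $(n,n)=1$, resp. $(n,n)=-1$, the discrete mean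 curvature $H$ is defined on faces by $A(f,n)+HA(f,f)=0$; $f$ is minimal, resp. maximal, if $H\equiv0$. Here $n=g^n-\mathfrak p$ for $\mu=1$ and $n=g^n+\mathfrak p$ for $\mu=-1$. For lightlike $\mathfrak p$, fix $\mathfrak o\in\mathcal L$ with $(\mathfrak o,\mathfrak p)=-1$; isotropic $3$-space is $I_{\mathfrak p,\mathfrak o}=\mathfrak o+\langle\mathfrak p\rangle^\perp$, and a circular surface $f$ in it, enveloped by a Legendre immersion $f+G$ with a section $g$ of $G$ having values in $I_{\mathfrak p,\mathfrak o}$, has mean curvature $H$ defined by $A(f,g)+HA(f,f)=0$ and is i-minimal if $H\equiv0$. *)

(* Defs.v *)
From HB Require Import structures.
From mathcomp Require Import all_boot all_order all_algebra.
From mathcomp Require Import classical_sets reals complex.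
From mathcomp Require Import ring lra.

Set Implicit Arguments.
Unset Strict Implicit.
Unset Printing Implicit Defensive.

Import Order.TTheory GRing.Theory Num.Theory.

Local Open Scope classical_set_scope.
Local Open Scope ring_scope.
Local Open Scope complex_scope.

Notation Z2 := (int * int)%type.

Definition edge (i j : Z2) : bool := `|i.1 - j.1| + `|i.2 - j.2| == 1.

(* A 4-cycle of the square grid, i.e. an elementary quadrilateral whose vertices
   are listed in cyclic order, with any starting vertex and either orientation. *)
Definition face (i j k l : Z2) : bool :=
  [&& edge i j, edge j k, edge k l, edge l i, i != k & j != l].

Notation vec R := 'rV[R]_4.

Definition ee (K : pzRingType) (k : 'I_4) : vec K := delta_mx 0 k.
Arguments ee {K} k.

Section Minkowski.
Variable R : realType.
Implicit Types (u v w p o : vec R) (D : {vspace vec R}).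

Definition mink u v : R :=
  - (u 0 0 * v 0 0) + u 0 1 * v 0 1 + u 0 2 * v 0 2 + u 0 3 * v 0 3.

Definition mx2 (a b c d : R[i]) : 'M[R[i]]_2 :=
  \matrix_(r, s) (if r == 0 then if s == 0 then a else b
                  else if s == 0 then c else d).

Definition herm v : 'M[R[i]]_2 :=
  (v 0 0)%:C *: mx2 1 0 0 1 + (v 0 1)%:C *: mx2 0 1 1 0
  + (v 0 2)%:C *: mx2 0 (0 +i* 1) (0 -i* 1) 0 + (v 0 3)%:C *: mx2 1 0 0 (- 1).

(* The inverse of [herm] on Hermitian matrices; see [of_hermK] and [hermK]. *)
Definition of_herm (M : 'M[R[i]]_2) : vec R :=
  (complex.Re (M 0 0 + M 1 1) / 2) *: ee 0 + complex.Re (M 0 1) *: ee 1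
  + complex.Im (M 0 1) *: ee 2 + (complex.Re (M 0 0 - M 1 1) / 2) *: ee 3.

Lemma of_herm_coord (M : 'M[R[i]]_2) :
  [/\ of_herm M 0 0 = complex.Re (M 0 0 + M 1 1) / 2,
      of_herm M 0 1 = complex.Re (M 0 1), of_herm M 0 2 = complex.Im (M 0 1)
    & of_herm M 0 3 = complex.Re (M 0 0 - M 1 1) / 2].
Proof.
by split; rewrite !mxE /= ?(mulr1, mulr0, addr0, add0r).
Qed.

Lemma herm_coord v :
  [/\ herm v 0 0 = (v 0 0 + v 0 3)%:C, herm v 0 1 = v 0 1 +i* v 0 2,
      herm v 1 0 = v 0 1 -i* v 0 2 & herm v 1 1 = (v 0 0 - v 0 3)%:C].
Proof.
split; rewrite !mxE /=; apply/eqP; rewrite eq_complex /=;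
  apply/andP; split; apply/eqP; ring.
Qed.

Lemma det_herm v : \det (herm v) = - (mink v v)%:C.
Proof.
have [h00 h01 h10 h11] := herm_coord v.
have det2 (M : 'M[R[i]]_2) : \det M = M 0 0 * M 1 1 - M 0 1 * M 1 0.
  rewrite (expand_det_row _ 0) big_ord_recl big_ord1 /cofactor !det_mx11 !mxE.
  rewrite expr0 expr1 mul1r mulN1r mulrN.
  by congr (M _ _ * M _ _ - M _ _ * M _ _); apply/val_inj.
rewrite det2 h00 h01 h10 h11 /mink; apply/eqP; rewrite eq_complex /=.
by apply/andP; split; apply/eqP; ring.
Qed.

Lemma of_hermK (M : 'M[R[i]]_2) :
  (forall r s, M r s = (M s r)^*) -> herm (of_herm M) = M.
Proof.
move=> hM; have [c0 c1 c2 c3] := of_herm_coord M.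
have [h00 h01 h10 h11] := herm_coord (of_herm M).
have ord2 (r : 'I_2) : r = 0 \/ r = 1.
  by case: r => [[|[|r]] hr] //; [left|right]; apply/val_inj.
have real r : M r r = (complex.Re (M r r))%:C.
  move: (hM r r); case: (M r r) => a b /= [] /eqP.
  by rewrite -addr_eq0 -mulr2n mulrn_eq0 /= => /eqP ->.
apply/matrixP => r s; case: (ord2 r) => ->; case: (ord2 s) => ->.
- by rewrite h00 c0 c3 [RHS]real raddfD raddfB /=; congr Complex; lra.
- by rewrite h01 c1 c2; case: (M 0 1).
- by rewrite h10 c1 c2 (hM 1 0); case: (M 0 1).
- by rewrite h11 c0 c3 [RHS]real raddfD raddfB /=; congr Complex; lra.
Qed.

Lemma hermK v : of_herm (herm v) = v.
Proof.
have [c0 c1 c2 c3] := of_herm_coord (herm v).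
have [h00 h01 h10 h11] := herm_coord v.
have ord4 (k : 'I_4) : [\/ k = 0, k = 1, k = 2 | k = 3].
  case: k => [[|[|[|[|k]]]] hk] //;
    [apply: Or41|apply: Or42|apply: Or43|apply: Or44]; exact/val_inj.
apply/rowP => k; case: (ord4 k) => ->.
- by rewrite c0 h00 h11 /=; lra.
- by rewrite c1 h01.
- by rewrite c2 h01.
- by rewrite c3 h00 h11 /=; lra.
Qed.

(* One-dimensional null subspaces, i.e. the points of the projective light cone. *)
Definition null_direction D : Prop :=
  \dim D = 1%N /\ (forall v, v \in D -> mink v v = 0).

Definition affine_subspace p D : set (vec R) := [set v | v - p \in D].

Definition affine_null_line (l : set (vec R)) : Prop :=
  exists p D, null_direction D /\ l = affine_subspace p D.

Definition parallel u v : Prop := exists w, u \in <[w]>%VS /\ v \in <[w]>%VS.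

(* The bivector of u and v, with the second exterior power realized as the
   space of antisymmetric matrices. *)
Definition wedge u v : 'M[R]_4 := u^T *m v - v^T *m u.

End Minkowski.

Section Surfaces.
Variable R : realType.
Implicit Types (x y f n g : Z2 -> vec R) (p o : vec R).
Implicit Types (L : Z2 -> set (vec R)) (G : Z2 -> {vspace vec R}).

Definition planar x : Prop := forall i j k l, face i j k l ->
  exists q (U : {vspace vec R}), (\dim U <= 2)%N /\
    [/\ affine_subspace q U (x i), affine_subspace q U (x j),
        affine_subspace q U (x k) & affine_subspace q U (x l)].

Definition circular x : Prop := planar x /\
  forall i j k l, face i j k l -> exists c, exists r : R,
    [/\ mink (x i - c) (x i - c) = r, mink (x j - c) (x j - c) = r,
        mink (x k - c) (x k - c) = r & mink (x l - c) (x l - c) = r].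

Definition edge_parallel x y : Prop :=
  forall i j, edge i j -> parallel (x i - x j) (y i - y j).

Definition mixed_area x y (i j k l : Z2) : 'M[R]_4 :=
  4^-1 *: (wedge (x i - x k) (y j - y l) - wedge (x j - x l) (y i - y k)).

Definition nondegenerate_area x : Prop :=
  forall i j k l, face i j k l -> mixed_area x x i j k l != 0.

Definition legendre L : Prop :=
  (forall i, affine_null_line (L i)) /\
  (forall i j, edge i j -> L i `&` L j !=set0).

Definition legendre_of x G : Z2 -> set (vec R) :=
  fun i => affine_subspace (x i) (G i).

Definition is_lightlike_gauss_map L G : Prop :=
  (forall i, null_direction (G i)) /\ (exists x, L = legendre_of x G).

Definition section_of_lines L y : Prop := forall i, L i (y i).

Definition section_of_directions G g : Prop :=
  forall i, g i != 0 /\ <[g i]>%VS = G i.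

Definition christoffel_dual x y : Prop :=
  [/\ edge_parallel x y, circular x, circular y &
      forall i j k l, face i j k l -> mixed_area x y i j k l = 0].

Definition Omega_dual L G : Prop :=
  [/\ legendre L, is_lightlike_gauss_map L G &
      exists y g, [/\ section_of_lines L y, section_of_directions G g &
                      christoffel_dual y g]].

(* H is a function on faces.  It is determined by this equation because of the
   nondegeneracy condition, which is the standing assumption on f. *)
Definition has_mean_curvature f n (H : Z2 -> Z2 -> Z2 -> Z2 -> R) : Prop :=
  [/\ circular f, nondegenerate_area f, edge_parallel f n &
      forall i j k l, face i j k l ->
        mixed_area f n i j k l + H i j k l *: mixed_area f f i j k l = 0].

Definition zero_mean_curvature f n : Prop :=
  has_mean_curvature f n (fun _ _ _ _ => 0).

Definition in_perp p x : Prop := forall i, mink (x i) p = 0.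

(* Minimal surfaces f with Gauss map n in the Euclidean space orthogonal to p. *)
Definition minimal_surface p f n : Prop :=
  mink p p = -1 /\
  [/\ in_perp p f, in_perp p n, forall i, mink (n i) (n i) = 1 &
      zero_mean_curvature f n].

(* Maximal surfaces f with Gauss map n in the Lorentzian space orthogonal to p. *)
Definition maximal_surface p f n : Prop :=
  mink p p = 1 /\
  [/\ in_perp p f, in_perp p n, forall i, mink (n i) (n i) = -1 &
      zero_mean_curvature f n].

Definition in_isotropic_space p o x : Prop := forall i, mink (x i - o) p = 0.

(* i-minimal surfaces f enveloped by the Legendre immersion f + G, where g is
   the section of G with values in the isotropic space. *)
Definition i_minimal_surface p o f G g : Prop :=
  [/\ mink p p = 0, mink o o = 0 & mink o p = -1] /\
  [/\ in_isotropic_space p o f, legendre (legendre_of f G),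
      section_of_directions G g, in_isotropic_space p o g &
      zero_mean_curvature f g].

Definition translate x (t : vec R) : Z2 -> vec R := fun i => x i + t.

End Surfaces.

Section Weierstrass.
Variable R : realType.
Implicit Types (phi : Z2 -> R[i]) (m : Z2 -> Z2 -> R) (mu : R).

(* Since z / 0 = 0, the negativity of the cross-ratio entails that its
   denominators (and the edge differences of phi) do not vanish. *)
Definition discrete_holomorphic phi m : Prop :=
  [/\ forall i j, edge i j -> m i j = m j i /\ m i j != 0,
      forall i j k l, face i j k l -> m i j = m l k /\ m i l = m j k &
      forall i j k l, face i j k l ->
        (phi i - phi j) / (phi j - phi k) * ((phi k - phi l) / (phi l - phi i))
          = (m i l / m i j)%:C /\ m i l / m i j < 0].

Definition normal_vec mu : vec R :=
  (2^-1 * (1 + mu)) *: ee 0 + (2^-1 * (1 - mu)) *: ee 3.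

Definition gauss_map phi (i : Z2) : {vspace vec R} :=
  <[of_herm (mx2 (`|phi i| ^+ 2) (phi i) (phi i)^* 1)]>%VS.

Definition weierstrass_edge mu phi m (i j : Z2) : vec R :=
  let M := mu%:C in
  map_mx (@complex.Re R)
    (((m i j)%:C * (phi i - phi j))^-1 *:
      (((1 - M) / 2 * (phi i + phi j)) *: ee 0
       + (1 - M * phi i * phi j) *: ee 1
       + ((0 +i* 1) * (1 + M * phi i * phi j)) *: ee 2
       + ((1 + M) / 2 * (phi i + phi j)) *: ee 3)).

Definition weierstrass_surface mu phi m (x : Z2 -> vec R) : Prop :=
  forall i j, edge i j -> x i - x j = weierstrass_edge mu phi m i j.

End Weierstrass.

(* Main.v *)
(* Write [W u v] for the real vector [Re (1 / (u - v) * (...))] of the Weierstrass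
   formula, so that [dx_ij = W phi_i phi_j / m_ij], and let [g z] be the null
   vector over [z] with [(g z, p) = -1].  Two identities carry everything:
   - [W u v = - (g u - g v) / (g u, g v)], so edges of [x] and [g] are parallel;
   - on a face, [W_ij / m_ij + W_jk / m_jk = (1 / m_il - 1 / m_ij) W_jl], by the
     cross-ratio condition.
   The second one, read on both halves of a face, gives closedness; read as a
   formula for the diagonals of [x], it shows that each diagonal of [x] is
   parallel to the other diagonal of [g] (vanishing mixed area), and that [g_l]
   lies in the affine span of [g_i, g_j, g_k] (planarity).  The face of [x] is
   circular with centre [x_j + c], where [c] is dual to the null vectors:
   [(c, g_i) = 1 / m_ij], [(c, g_j) = 0], [(c, g_k) = 1 / m_jk]. *)
Require Import Defs.
From mathcomp Require Import all_boot all_order all_algebra.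
From mathcomp Require Import classical_sets reals complex.
From mathcomp Require Import ssrAC ring lra zify.

Import Order.TTheory GRing.Theory Num.Theory.

Local Open Scope ring_scope.
Local Open Scope complex_scope.

(** * Summation and integration on the integer grid *)

Lemma int_step_ind (P : int -> Prop) :
  P 0 -> (forall n, P n <-> P (n + 1)) -> forall n, P n.
Proof.
move=> P0 PS; elim=> [//|n IH|n IH]; first by rewrite -addn1 PoszD; apply: (PS _).1.
by apply: (PS _).2; rewrite -addn1 PoszD opprD addrNK.
Qed.

Lemma int_antidifference (V : zmodType) (f : int -> V) :
  exists F : int -> V, forall n, F (n + 1) - F n = f n.
Proof.
(* Values of [f] are summed upwards from 0 and subtracted downwards. Since [Negz k] is [-(k+1)], the
   negative branch has [k.+1] terms, and the passage from -1 to 0 is a case of its own. *)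
exists (fun n => match n with
  | Posz k => \sum_(j < k) f j%:Z
  | Negz k => - \sum_(j < k.+1) f (Negz j) end) => -[n|[|n]].
- by rewrite -PoszD addn1 big_ord_recr /= addrAC subrr add0r.
- by rewrite /= big_ord0 big_ord1 sub0r opprK.
- have -> : Negz n.+1 + 1 = Negz n by lia.
  by rewrite opprK [X in _ + X]big_ord_recr /= addKr.
Qed.

Lemma edgeP (i j : Z2) : edge i j ->
  [\/ i = (j.1 + 1, j.2), j = (i.1 + 1, i.2), i = (j.1, j.2 + 1)
    | j = (i.1, i.2 + 1)].
Proof.
case: i j => [a b] [c d]; rewrite /edge /= => /eqP h.
have [[->->]|[[->->]|[[->->]|[->->]]]] : (a = c + 1 /\ b = d) \/
  (c = a + 1 /\ d = b) \/ (a = c /\ b = d + 1) \/ (c = a /\ d = b + 1) by lia.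
- exact: Or41.
- exact: Or42.
- exact: Or43.
- exact: Or44.
Qed.

Lemma face_unit (a b : int) :
  face (a, b) (a + 1, b) (a + 1, b + 1) (a, b + 1).
Proof. by rewrite /face /edge /= !xpair_eqE; lia. Qed.

Lemma face_rot i j k l : face i j k l -> face j k l i.
Proof.
case/and5P=> ? ? ? ? /andP[? ?]; apply/and5P; split=> //.
by rewrite (eq_sym k); apply/andP.
Qed.

(** The cross-ratio condition lives on faces; this carries its consequences, such as
    [phi i != phi j], over to single edges. *)
Lemma edge_in_face i j : edge i j -> exists k l, face i j k l.
Proof.
case: i j => [a b] [c d] /edgeP[[-> ->]|[-> ->]|[-> ->]|[-> ->]] /=;
  [exists (c, d + 1), (c + 1, d + 1)|exists (a + 1, b + 1), (a, b + 1)
  |exists (c + 1, d), (c + 1, d + 1)|exists (a + 1, b + 1), (a + 1, b)];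
  rewrite /face /edge /= !xpair_eqE; lia.
Qed.

(* Sum along the horizontal axis first, then vertically; closedness on the faces
   makes the vertical sums compatible with the horizontal differences. *)
Lemma grid_integrable (V : zmodType) (E : Z2 -> Z2 -> V) :
  (forall i j, edge i j -> E j i = - E i j) ->
  (forall i j k l, face i j k l -> E i j + E j k + E k l + E l i = 0) ->
  exists x : Z2 -> V, forall i j, edge i j -> x i - x j = E i j.
Proof.
move=> Easym Eclosed.
have Ex a b : edge (a + 1, b) (a, b) by rewrite /edge /=; lia.
have Ey a b : edge (a, b + 1) (a, b) by rewrite /edge /=; lia.
have [H hH] := int_antidifference _ (fun a => E (a + 1, 0) (a, 0)).
have /boolp.choice [W hW] a := int_antidifference _ (fun b => E (a, b + 1) (a, b)).
pose x (i : Z2) := H i.1 + (W i.1 i.2 - W i.1 0).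
have xy a b : x (a, b + 1) - x (a, b) = E (a, b + 1) (a, b).
  by rewrite /x /= -hW opprD addrACA subrr add0r opprB addrA addrNK.
have xx a b : x (a + 1, b) - x (a, b) = E (a + 1, b) (a, b).
  elim/int_step_ind: b => [|b]; first by rewrite /x /= !subrr !addr0.
  have key : x (a + 1, b + 1) - x (a, b + 1) - E (a + 1, b + 1) (a, b + 1) =
             x (a + 1, b) - x (a, b) - E (a + 1, b) (a, b).
    have := Eclosed _ _ _ _ (face_unit a b).
    rewrite (Easym (a + 1, b)) // (Easym (a + 1, b + 1) (a + 1, b)) // -!xy.
    move: (E _ _) (E _ _) (x _) (x _) (x _) (x _) => t b' x00 x01 x10 x11 h.
    apply/eqP; rewrite -subr_eq0 -oppr_eq0 -h; apply/eqP.
    by rewrite !opprD !opprK !addrA [RHS](ACl (2*5*4*3*6*1)).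
  split=> /eqP; rewrite -subr_eq0 => h; apply/eqP; rewrite -subr_eq0.
    by rewrite key.
  by rewrite -key.
exists x => -[a b] [c d] /edgeP[[-> ->]|[-> ->]|[-> ->]|[-> ->]] /=.
- exact: xx.
- by rewrite -opprB xx -Easym.
- exact: xy.
- by rewrite -opprB xy -Easym.
Qed.

Lemma grid_constant (V : zmodType) (x : Z2 -> V) :
  (forall i j, edge i j -> x i = x j) -> forall i, x i = x (0, 0).
Proof.
move=> hx [a b]; transitivity (x (a, 0)).
  elim/int_step_ind: b => [//|b]; suff -> : x (a, b + 1) = x (a, b) by [].
  by apply: hx; rewrite /edge /=; lia.
elim/int_step_ind: a => [//|a]; suff -> : x (a + 1, 0) = x (a, 0) by [].
by apply: hx; rewrite /edge /=; lia.
Qed.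

(** * Bilinear algebra of the Minkowski product *)

Section MinkowskiAlgebra.
Variable R : realType.
Implicit Types u v w : vec R.

Lemma vecP u v :
  u 0 0 = v 0 0 -> u 0 1 = v 0 1 -> u 0 2 = v 0 2 -> u 0 3 = v 0 3 -> u = v.
Proof.
move=> h0 h1 h2 h3; apply/rowP => -[[|[|[|[|k]]]] hk] //.
- by rewrite (_ : Ordinal hk = 0) //; apply: val_inj.
- by rewrite (_ : Ordinal hk = 1) //; apply: val_inj.
- by rewrite (_ : Ordinal hk = 2) //; apply: val_inj.
- by rewrite (_ : Ordinal hk = 3) //; apply: val_inj.
Qed.

Lemma minkC u v : mink u v = mink v u.
Proof. by rewrite /mink; ring. Qed.

Lemma minkDl u v w : mink (u + v) w = mink u w + mink v w.
Proof. by rewrite /mink !mxE; ring. Qed.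

Lemma minkDr u v w : mink w (u + v) = mink w u + mink w v.
Proof. by rewrite /mink !mxE; ring. Qed.

Lemma minkNl u w : mink (- u) w = - mink u w.
Proof. by rewrite /mink !mxE; ring. Qed.

Lemma minkNr u w : mink w (- u) = - mink w u.
Proof. by rewrite /mink !mxE; ring. Qed.

Lemma minkZl (a : R) u w : mink (a *: u) w = a * mink u w.
Proof. by rewrite /mink !mxE; ring. Qed.

Lemma minkZr (a : R) u w : mink w (a *: u) = a * mink w u.
Proof. by rewrite /mink !mxE; ring. Qed.

Definition minkE := (minkDl, minkNl, minkZl, minkDr, minkNr, minkZr).

Lemma null_direction_line u : u != 0 -> mink u u = 0 -> null_direction <[u]>.
Proof.
move=> u0 uu; split; first by rewrite dim_vline u0.
by move=> v /vlineP[k ->]; rewrite !minkE uu !mulr0.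
Qed.

(** The Gram matrix of three null vectors has determinant twice the product of their mutual
    products, so prescribed products with them are attained inside their span. *)
Lemma null_dual_basis g1 g2 g3 (s t : R) :
  mink g1 g1 = 0 -> mink g2 g2 = 0 -> mink g3 g3 = 0 ->
  mink g1 g2 != 0 -> mink g2 g3 != 0 -> mink g1 g3 != 0 ->
  exists c, [/\ mink c g1 = s, mink c g2 = 0 & mink c g3 = t].
Proof.
move=> h11 h22 h33 h12 h23 h13.
have N := (minkE, h11, h22, h33, minkC g2 g1, minkC g3 g1, minkC g3 g2).
(* The first bracket is orthogonal to [g2] and [g3], and its product with [g1] is
   [2 * mink g1 g2 * mink g1 g3]; the second does the same with [g1] and [g3] exchanged. *)
exists ((s / (2 * mink g1 g2 * mink g1 g3)) *:
          (mink g1 g3 *: g2 + mink g1 g2 *: g3 - mink g2 g3 *: g1)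
      + (t / (2 * mink g1 g3 * mink g2 g3)) *:
          (mink g1 g3 *: g2 + mink g2 g3 *: g1 - mink g1 g2 *: g3)).
by split; rewrite !N; field; rewrite ?h12 ?h23 ?h13.
Qed.

Lemma parallel_scale (a : R) u v : u = a *: v -> parallel u v.
Proof. by move=> ->; exists v; rewrite memvZ memv_line. Qed.

Lemma wedgevv u : wedge u u = 0.
Proof. by rewrite /wedge subrr. Qed.

Lemma wedgeZl (a : R) u v : wedge (a *: u) v = a *: wedge u v.
Proof. by rewrite /wedge linearZ /= -!scalemxAl -scalemxAr scalerBr. Qed.

End MinkowskiAlgebra.

(** * Real parts and the cross-ratio identity *)

Section ComplexPlane.
Variable R : realType.
Implicit Types u v : R[i].

Lemma complex_Re_div u v : complex.Re (u / v) =
  (complex.Re u * complex.Re v + complex.Im u * complex.Im v) /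
    (complex.Re v ^+ 2 + complex.Im v ^+ 2).
Proof. by case: u v => [a b] [c d] /=; ring. Qed.

Lemma complex_ReZ (r : R) u : complex.Re (r%:C * u) = r * complex.Re u.
Proof. by case: u => a b /=; ring. Qed.

Lemma sqr_dist_neq0 u v : u != v ->
  (complex.Re u - complex.Re v) ^+ 2 + (complex.Im u - complex.Im v) ^+ 2 != 0.
Proof.
apply: contra; rewrite paddr_eq0 ?sqr_ge0 // !sqrf_eq0 !subr_eq0.
by rewrite -eq_complex.
Qed.

(* The difference of the two sides, with denominators cleared, is
   [e0 + 2 * e1 * j + e2 * j ^+ 2] times that of the cross-ratio equation. *)
Lemma cross_ratio_diagonal (F : fieldType) (a b e0 e1 e2 i j k l : F) :
  a != 0 -> b != 0 -> i != j -> j != k -> j != l ->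
  a * (i - j) * (k - l) = b * (j - k) * (l - i) ->
  a^-1 * ((e0 + e1 * (i + j) + e2 * i * j) / (i - j)) +
  b^-1 * ((e0 + e1 * (j + k) + e2 * j * k) / (j - k)) =
  (b^-1 - a^-1) * ((e0 + e1 * (j + l) + e2 * j * l) / (j - l)).
Proof.
move=> a0 b0; rewrite -(subr_eq0 i) -(subr_eq0 j) -(subr_eq0 j l) => ij jk jl h.
apply/eqP; rewrite -subr_eq0; apply/eqP.
transitivity ((e0 + 2 * e1 * j + e2 * j ^+ 2) *
    (a * (i - j) * (k - l) - b * (j - k) * (l - i)) /
    (a * b * (i - j) * (j - k) * (j - l))); last by rewrite h subrr mulr0 mul0r.
by field; rewrite a0 b0 ij jk jl.
Qed.

Lemma map_Re_coord (x a0 a1 a2 a3 : R[i])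
    (w := map_mx (@complex.Re R)
            (x *: (a0 *: ee 0 + a1 *: ee 1 + a2 *: ee 2 + a3 *: ee 3))) :
  [/\ w 0 0 = complex.Re (a0 * x), w 0 1 = complex.Re (a1 * x),
      w 0 2 = complex.Re (a2 * x) & w 0 3 = complex.Re (a3 * x)].
Proof.
by split; rewrite /w mxE; congr complex.Re; rewrite !mxE /=
  !(mulr1, mulr0, addr0, add0r) mulrC.
Qed.

End ComplexPlane.

(** * Null lifts of complex numbers and the Weierstrass vector *)

Section NullVectors.
Variable R : realType.
Variable mu : R.
Implicit Types u v z : R[i].

Let p : vec R := normal_vec mu.

(* The Hermitian matrix [v v^*] of the column [v = (z, 1)^T]. *)
Definition nullvec z : vec R := of_herm (mx2 (`|z| ^+ 2) z z^* 1).

(** The number [1 + mu |z|^2] as an element of [R]; it equals -2 times the product of [nullvec z]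
    with [p], whence the factor [2 / weight z] in [unit_section]. *)
Definition weight z : R := 1 + mu * (complex.Re z ^+ 2 + complex.Im z ^+ 2).

Definition unit_section z : vec R := (2 / weight z) *: nullvec z.

Lemma weight_neq0 z : (1 + mu%:C * `|z| ^+ 2 != 0) = (weight z != 0).
Proof.
rewrite -add_Re2_Im2 -rmorphM -(rmorph1 (real_complex R)) -rmorphD /=.
by rewrite -(rmorph0 (real_complex R)) (inj_eq (@complexI R)).
Qed.

Lemma nullvec_coord z (s := complex.Re z ^+ 2 + complex.Im z ^+ 2) :
  [/\ nullvec z 0 0 = (s + 1) / 2, nullvec z 0 1 = complex.Re z,
      nullvec z 0 2 = complex.Im z & nullvec z 0 3 = (s - 1) / 2].
Proof.
have [-> -> -> ->] := of_herm_coord (mx2 (`|z| ^+ 2) z z^* 1).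
by rewrite -add_Re2_Im2 !mxE.
Qed.

Lemma nullvec_neq0 z : nullvec z != 0.
Proof.
have [h0 _ _ h3] := nullvec_coord z; apply/eqP => h; move: h0 h3.
by rewrite h !mxE {h} => h0 h3; lra.
Qed.

(** The usual light cone model of the plane: products of lifts measure squared distances, so lifts
    of distinct points are never orthogonal. *)
Lemma mink_nullvec z v : mink (nullvec z) (nullvec v) =
  - ((complex.Re z - complex.Re v) ^+ 2 + (complex.Im z - complex.Im v) ^+ 2) / 2.
Proof.
have [a0 a1 a2 a3] := nullvec_coord z; have [b0 b1 b2 b3] := nullvec_coord v.
by rewrite /mink a0 a1 a2 a3 b0 b1 b2 b3; field.
Qed.

Lemma normal_vec_coord : [/\ p 0 0 = (1 + mu) / 2, p 0 1 = 0, p 0 2 = 0 &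
  p 0 3 = (1 - mu) / 2].
Proof. by split; rewrite !mxE /=; field. Qed.

Lemma mink_nullvec_normal z : mink (nullvec z) p = - weight z / 2.
Proof.
have [a0 a1 a2 a3] := nullvec_coord z; have [b0 b1 b2 b3] := normal_vec_coord.
by rewrite /mink a0 a1 a2 a3 b0 b1 b2 b3 /weight; field.
Qed.

Lemma unit_section_null z : mink (unit_section z) (unit_section z) = 0.
Proof. by rewrite /unit_section minkZl minkZr mink_nullvec !subrr; ring. Qed.

Lemma mink_unit_section_normal z : weight z != 0 -> mink (unit_section z) p = -1.
Proof. by move=> w0; rewrite /unit_section minkZl mink_nullvec_normal; field. Qed.

Lemma mink_unit_section z v : weight z != 0 -> weight v != 0 -> z != v ->
  mink (unit_section z) (unit_section v) != 0.
Proof.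
move=> wz wv zv; rewrite /unit_section minkZl minkZr mink_nullvec.
have d0 := sqr_dist_neq0 _ _ _ zv.
by rewrite !mulf_neq0 ?invr_eq0 ?oppr_eq0 ?pnatr_eq0.
Qed.

Lemma section_unique (g : vec R) z : <[g]>%VS = <[nullvec z]>%VS ->
  mink g p = -1 -> weight z != 0 -> g = unit_section z.
Proof.
move=> hg gp w0; have /vlineP[k gk] : g \in <[nullvec z]>%VS by rewrite -hg memv_line.
move: gp; rewrite gk minkZl mink_nullvec_normal /unit_section => h; congr (_ *: _).
by apply: (mulIf w0); rewrite divfK //; lra.
Qed.

Lemma section_line z : weight z != 0 ->
  unit_section z != 0 /\ <[unit_section z]>%VS = <[nullvec z]>%VS.
Proof.
move=> w0; have k0 : 2 / weight z != 0 by rewrite mulf_neq0 ?invr_eq0 ?pnatr_eq0.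
split; first by rewrite scaler_eq0 negb_or k0 nullvec_neq0.
apply/eqP; rewrite eqEsubv; apply/andP; split; rewrite -memvE.
  by rewrite memvZ ?memv_line.
by rewrite -[X in X \in _](scalerK k0) memvZ ?memv_line.
Qed.

Definition weierstrass_vec u v : vec R :=
  map_mx (@complex.Re R)
    ((u - v)^-1 *:
      (((1 - mu%:C) / 2 * (u + v)) *: ee 0
       + (1 - mu%:C * u * v) *: ee 1
       + ((0 +i* 1) * (1 + mu%:C * u * v)) *: ee 2
       + ((1 + mu%:C) / 2 * (u + v)) *: ee 3)).

Lemma weierstrass_vecC u v : weierstrass_vec u v = - weierstrass_vec v u.
Proof.
rewrite /weierstrass_vec -[u - v]opprB invrN scaleNr.
by rewrite (addrC u) !(mulrAC _ u) map_mxN.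
Qed.

Lemma weierstrass_vec_coord u v
    (a := complex.Re u) (b := complex.Im u) (c := complex.Re v) (d := complex.Im v)
    (N := (a - c) ^+ 2 + (b - d) ^+ 2) :
  [/\ weierstrass_vec u v 0 0 =
        (1 - mu) / 2 * (a ^+ 2 + b ^+ 2 - c ^+ 2 - d ^+ 2) / N,
      weierstrass_vec u v 0 1 =
        (a - c + mu * (a * (c ^+ 2 + d ^+ 2) - c * (a ^+ 2 + b ^+ 2))) / N,
      weierstrass_vec u v 0 2 =
        (b - d + mu * (b * (c ^+ 2 + d ^+ 2) - d * (a ^+ 2 + b ^+ 2))) / N
    & weierstrass_vec u v 0 3 =
        (1 + mu) / 2 * (a ^+ 2 + b ^+ 2 - c ^+ 2 - d ^+ 2) / N].
Proof.
have [-> -> -> ->] := map_Re_coord R (u - v)^-1 ((1 - mu%:C) / 2 * (u + v))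
  (1 - mu%:C * u * v) ((0 +i* 1) * (1 + mu%:C * u * v)) ((1 + mu%:C) / 2 * (u + v)).
have half (r : R) : r%:C / 2 = (r / 2)%:C by rewrite rmorphM fmorphV rmorph_nat.
have subC : 1 - mu%:C = (1 - mu)%:C by rewrite rmorphB rmorph1.
have addC : 1 + mu%:C = (1 + mu)%:C by rewrite rmorphD rmorph1.
rewrite {}/N {}/a {}/b {}/c {}/d; move: u v => [a b] [c d].
by split; rewrite complex_Re_div ?subC ?addC ?half /=; congr (_ / _); ring.
Qed.

(** The product of the two sections is [-2 |u - v|^2 / (weight u * weight v)], so the right side is
    [(weight v *: nullvec u - weight u *: nullvec v) / |u - v|^2], which has no weight in a
    denominator and agrees with the left side coordinatewise. *)
Lemma weierstrass_vec_section u v : weight u != 0 -> weight v != 0 -> u != v ->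
  weierstrass_vec u v = - (mink (unit_section u) (unit_section v))^-1 *:
    (unit_section u - unit_section v).
Proof.
move=> wu wv uv; have N0 := sqr_dist_neq0 _ _ _ uv.
have [w0 w1 w2 w3] := weierstrass_vec_coord u v.
have [a0 a1 a2 a3] := nullvec_coord u; have [b0 b1 b2 b3] := nullvec_coord v.
rewrite /unit_section minkZl minkZr mink_nullvec.
have E (r s t : R) (x y : vec R) k :
  (- r *: (s *: x - t *: y)) 0 k = - r * (s * x 0 k - t * y 0 k) by rewrite !mxE.
apply: vecP; rewrite E ?(w0, a0, b0) ?(w1, a1, b1) ?(w2, a2, b2) ?(w3, a3, b3).
all: by rewrite /weight in wu wv *; field; rewrite ?wu ?wv ?N0.
Qed.

Lemma weierstrass_vec_diagonal (a b : R) (i j k l : R[i]) :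
  a != 0 -> b != 0 -> i != j -> j != k -> j != l ->
  a%:C * (i - j) * (k - l) = b%:C * (j - k) * (l - i) ->
  a^-1 *: weierstrass_vec i j + b^-1 *: weierstrass_vec j k =
    (b^-1 - a^-1) *: weierstrass_vec j l.
Proof.
move=> a0 b0 ij jk jl h.
have cV (r : R) : (r^-1)%:C = r%:C^-1 by rewrite fmorphV.
(* Every coefficient in the formula is a symmetric polynomial, affine in each variable, over
   [u - v]. Since [a] and [b] are real, taking real parts preserves the complex identity; only [e0],
   [e1], [e2] change from coordinate to coordinate. *)
have D (e0 e1 e2 : R[i]) (w : R[i] -> R[i] -> R[i]) :
    (forall u v, w u v = (e0 + e1 * (u + v) + e2 * u * v) * (u - v)^-1) ->
    a^-1 * complex.Re (w i j) + b^-1 * complex.Re (w j k) =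
    (b^-1 - a^-1) * complex.Re (w j l).
  move=> hw; rewrite -!complex_ReZ -raddfD rmorphB /= !cV !hw; congr complex.Re.
  apply: cross_ratio_diagonal => //; apply/eqP => -[]; exact/eqP.
have E (r s : R) (x y : vec R) n : (r *: x + s *: y) 0 n = r * x 0 n + s * y 0 n.
  by rewrite !mxE.
have E1 (r : R) (x : vec R) n : (r *: x) 0 n = r * x 0 n by rewrite mxE.
pose w0 u v := (1 - mu%:C) / 2 * (u + v) / (u - v).
pose w1 u v := (1 - mu%:C * u * v) / (u - v).
pose w2 u v := (0 +i* 1) * (1 + mu%:C * u * v) / (u - v).
pose w3 u v := (1 + mu%:C) / 2 * (u + v) / (u - v).
have C u v : [/\ weierstrass_vec u v 0 0 = complex.Re (w0 u v),
    weierstrass_vec u v 0 1 = complex.Re (w1 u v),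
    weierstrass_vec u v 0 2 = complex.Re (w2 u v)
  & weierstrass_vec u v 0 3 = complex.Re (w3 u v)] by apply: map_Re_coord.
move: (C i j) (C j k) (C j l).
move: (weierstrass_vec i j) (weierstrass_vec j k) (weierstrass_vec j l) => X Y Z.
move=> [c0 c1 c2 c3] [d0 d1 d2 d3] [f0 f1 f2 f3].
apply: vecP; rewrite E E1.
- rewrite c0 d0 f0.
  by apply: (D 0 ((1 - mu%:C) / 2) 0) => u v; rewrite /w0; ring.
- rewrite c1 d1 f1.
  by apply: (D 1 0 (- mu%:C)) => u v; rewrite /w1; ring.
- rewrite c2 d2 f2.
  by apply: (D (0 +i* 1) 0 ((0 +i* 1) * mu%:C)) => u v; rewrite /w2; ring.
- rewrite c3 d3 f3.
  by apply: (D 0 ((1 + mu%:C) / 2) 0) => u v; rewrite /w3; ring.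
Qed.

End NullVectors.

(** * Geometry of a single face *)

(** With centre [xj + c] and value [mink c c], a point [x] is on the sphere iff
    [(x - xj, x - xj) = 2 (c, x - xj)]. For differences of null vectors the left side reduces to one
    mutual product, and the prescribed products of [c] match it at all vertices. *)
Lemma null_quad_cocyclic {R : realType} {a b : R} {gi gj gk xi xj xk xl : vec R} :
  a != 0 -> b != 0 ->
  mink gi gi = 0 -> mink gj gj = 0 -> mink gk gk = 0 ->
  mink gi gj != 0 -> mink gj gk != 0 -> mink gi gk != 0 ->
  xi - xj = a^-1 *: (- (mink gi gj)^-1 *: (gi - gj)) ->
  xj - xk = b^-1 *: (- (mink gj gk)^-1 *: (gj - gk)) ->
  xj - xl = (b^-1 - a^-1) *: (- (mink gi gk)^-1 *: (gi - gk)) ->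
  exists c, exists r : R,
    [/\ mink (xi - c) (xi - c) = r, mink (xj - c) (xj - c) = r,
        mink (xk - c) (xk - c) = r & mink (xl - c) (xl - c) = r].
Proof.
move=> a0 b0 ii jj kk ij jk ik exi exk exl.
have [c [ci cj ck]] := null_dual_basis R gi gj gk a^-1 b^-1 ii jj kk ij jk ik.
have N := (minkC R gi c, minkC R gj c, minkC R gk c,
  minkC R gj gi, minkC R gk gi, minkC R gk gj).
have S x : (x - (xj + c)) = - ((xj - x) + c) by rewrite [RHS]opprD opprB opprD addrA.
exists (xj + c), (mink c c).
split; rewrite S !(minkNl, minkNr) opprK.
- rewrite -opprB exi !minkE !N ii jj ci cj; field; rewrite ?a0 ?ij //.
- by rewrite subrr add0r.
- rewrite exk !minkE !N jj kk cj ck; field; rewrite ?b0 ?jk //.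
- rewrite exl !minkE !N ii kk ci ck; field; rewrite ?a0 ?b0 ?ik //.
Qed.

Lemma coplanar_spanned {R : realType} (u v : vec R) (y : Z2 -> vec R) i j k l :
  y i - y j \in (<[u]> + <[v]>)%VS -> y k - y j \in (<[u]> + <[v]>)%VS ->
  y l - y j \in (<[u]> + <[v]>)%VS ->
  exists q (U : {vspace vec R}), (\dim U <= 2)%N /\
    [/\ affine_subspace q U (y i), affine_subspace q U (y j),
        affine_subspace q U (y k) & affine_subspace q U (y l)].
Proof.
move=> hi hk hl; exists (y j), (<[u]> + <[v]>)%VS; split.
  by apply: (leq_trans (dimv_add_leqif _ _)); rewrite !dim_vline; case: eqP; case: eqP.
by split; rewrite // /affine_subspace /= subrr mem0v.
Qed.

(** A negative cross-ratio is neither 0 nor 1: the first separates adjacent vertices, the second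
    opposite vertices and the two labels. *)
Lemma holomorphic_face {R : realType} {phi : Z2 -> R[i]} {m i j k l} :
  discrete_holomorphic phi m -> face i j k l ->
  [/\ m i j != 0, m i l != 0, m i l != m i j & m j k = m i l] /\
  [/\ phi i != phi j, phi j != phi k, phi i != phi k, phi j != phi l &
      (m i j)%:C * (phi i - phi j) * (phi k - phi l) =
      (m i l)%:C * (phi j - phi k) * (phi l - phi i)].
Proof.
case=> hm1 hm2 hcr f; have [_ mjk] := hm2 _ _ _ _ f.
have [cr neg] := hcr _ _ _ _ f; case/and5P: f => eij _ _ eli _.
have [mil ml0] := hm1 _ _ eli.
have [_ mij0] := hm1 _ _ eij; rewrite mil in ml0.
have : (m i l / m i j)%:C != 0.
  by rewrite -(rmorph0 (real_complex R)) (inj_eq (@complexI R)) lt_eqF.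
rewrite -cr !mulf_eq0 !invr_eq0 !negb_or => /andP[/andP[ij jk] /andP[kl li]].
(* If [phi i = phi k] or [phi j = phi l], the factors of the cross-ratio cancel to 1. *)
have ne1 : (m i l / m i j)%:C != 1.
  rewrite -(rmorph1 (real_complex R)) (inj_eq (@complexI R)).
  by apply/eqP => e; move: neg; rewrite e ltr10.
split; first split=> //.
  by apply/eqP => e; move: neg; rewrite e divff // ltr10.
rewrite -!(subr_eq0 (phi i)) -!(subr_eq0 (phi j)); split=> //.
- apply: contra ne1; rewrite -cr subr_eq0 => /eqP e; move: li.
  by rewrite e => li0; apply/eqP; field; rewrite jk li0.
- apply: contra ne1; rewrite -cr subr_eq0 => /eqP e; move: jk.
  by rewrite e => jk0; apply/eqP; field; rewrite jk0 li.
move: cr; rewrite rmorphM fmorphV => cr.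
have mC0 : (m i j)%:C != 0.
  by rewrite -(rmorph0 (real_complex R)) (inj_eq (@complexI R)).
apply/eqP; rewrite -subr_eq0; apply/eqP.
transitivity ((m i j)%:C * (phi j - phi k) * (phi l - phi i) *
 ((phi i - phi j) / (phi j - phi k) * ((phi k - phi l) / (phi l - phi i)) -
   (m i l)%:C / (m i j)%:C)); first by field; rewrite mC0 jk li.
by rewrite cr subrr mulr0.
Qed.

(** * The Weierstrass surface and its duality with the Gauss map *)

Section WeierstrassSurface.
Variable R : realType.
Variables (phi : Z2 -> R[i]) (m : Z2 -> Z2 -> R) (mu : R).
Hypothesis hphi : discrete_holomorphic phi m.
Hypothesis hw : forall i, weight R mu (phi i) != 0.

Let g i := unit_section R mu (phi i).
Let W i j := weierstrass_vec R mu (phi i) (phi j).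

Lemma weierstrass_edgeE i j : weierstrass_edge mu phi m i j = (m i j)^-1 *: W i j.
Proof.
rewrite /W /weierstrass_edge /weierstrass_vec invfM -fmorphV.
apply/rowP => n; rewrite [LHS]mxE [RHS]mxE [in RHS]mxE.
by rewrite -complex_ReZ; congr complex.Re; rewrite [LHS]mxE [in RHS]mxE mulrA.
Qed.

Lemma edge_data i j : edge i j ->
  [/\ m i j != 0, m j i = m i j & phi i != phi j].
Proof.
move=> e; have [k [l f]] := edge_in_face _ _ e.
have [[? _ _ _] [? _ _ _ _]] := holomorphic_face hphi f.
by split=> //; case: hphi => h _ _; case: (h _ _ e).
Qed.

Lemma W_section i j : phi i != phi j ->
  W i j = - (mink (g i) (g j))^-1 *: (g i - g j).
Proof. by move=> ij; apply: weierstrass_vec_section. Qed.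

Lemma W_diagonal i j k l : face i j k l ->
  (m i j)^-1 *: W i j + (m j k)^-1 *: W j k = ((m i l)^-1 - (m i j)^-1) *: W j l.
Proof.
case/(holomorphic_face hphi) => -[? ? _ ->] [? ? _ ? ?].
exact: weierstrass_vec_diagonal.
Qed.

Lemma mink_g_neq0 i j : phi i != phi j -> mink (g i) (g j) != 0.
Proof. by move=> ij; apply: mink_unit_section. Qed.

Lemma weierstrass_exists : exists x, weierstrass_surface mu phi m x.
Proof.
apply: grid_integrable => [i j e|i j k l f]; rewrite !weierstrass_edgeE.
  by have [_ -> _] := edge_data _ _ e; rewrite /W weierstrass_vecC scalerN.
(* The half turn reads the face from [k], so that the path from [k] over [l] to [i] is again a
   diagonal formula. By equality of opposite labels it has the same coefficient, with [W l j] in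
   place of [W j l], and the two cancel. *)
have f' := face_rot _ _ _ _ (face_rot _ _ _ _ f).
rewrite -addrA; apply: etrans (congr2 +%R (W_diagonal _ _ _ _ f)
  (W_diagonal _ _ _ _ f')) _.
have [ij jk] : m i j = m l k /\ m i l = m j k by case: hphi => _ h _; apply: h.
case/and5P: f => _ /edge_data[_ -> _] /edge_data[_ kl _] _ _.
by rewrite ij -kl jk /W (weierstrass_vecC _ _ (phi l)) scalerN subrr.
Qed.

Lemma weierstrass_unique x y :
  weierstrass_surface mu phi m x -> weierstrass_surface mu phi m y ->
  exists t, forall i, y i = x i + t.
Proof.
move=> hx hy; exists (y (0, 0) - x (0, 0)) => i.
have := grid_constant _ (fun i => y i - x i) _ i => <-; first by rewrite addrC subrK.
move=> {}i j e; apply/eqP; rewrite subr_eq addrAC -addrA (hx _ _ e) -(hy _ _ e).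
by rewrite addrC subrK.
Qed.

Variable x : Z2 -> vec R.
Hypothesis hx : weierstrass_surface mu phi m x.

Lemma surface_edge i j : edge i j ->
  x i - x j = (m i j)^-1 *: (- (mink (g i) (g j))^-1 *: (g i - g j)).
Proof.
move=> e; rewrite hx // weierstrass_edgeE W_section //.
by case: (edge_data _ _ e).
Qed.

Lemma surface_diagonal i j k l : face i j k l ->
  x i - x k = ((m i l)^-1 - (m i j)^-1) *: (- (mink (g j) (g l))^-1 *: (g j - g l)).
Proof.
move=> f; rewrite -W_section; last by case: (holomorphic_face hphi f) => _ [].
apply: etrans (W_diagonal _ _ _ _ f); case/and5P: f => eij ejk _ _ _.
by rewrite -(subrK (x j) (x i)) -addrA (hx _ _ eij) (hx _ _ ejk) !weierstrass_edgeE.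
Qed.

(** A quarter turn of the face exchanges the two labels and reverses the diagonal of [g]; the two
    signs cancel. *)
Lemma surface_diagonal' i j k l : face i j k l ->
  x j - x l = ((m i l)^-1 - (m i j)^-1) *: (- (mink (g i) (g k))^-1 *: (g i - g k)).
Proof.
move=> f; rewrite (surface_diagonal _ _ _ _ (face_rot _ _ _ _ f)).
have [[_ _ _ ->] _] := holomorphic_face hphi f.
have -> : m j i = m i j by case/and5P: f => /edge_data[].
rewrite (minkC R (g k)) -(opprB (g i)).
by rewrite -[X in X *: _ = _]opprB !scalerN scaleNr opprK.
Qed.

Lemma surface_edge_parallel : edge_parallel x g.
Proof.
by move=> i j e; rewrite (surface_edge _ _ e) scalerA; apply: parallel_scale.
Qed.

Lemma surface_mixed_area i j k l : face i j k l -> mixed_area x g i j k l = 0.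
Proof.
move=> f; rewrite /mixed_area (surface_diagonal _ _ _ _ f).
by rewrite (surface_diagonal' _ _ _ _ f) !wedgeZl !wedgevv !scaler0 subrr scaler0.
Qed.

(** All values are null, so the origin serves as centre with value 0. Planarity comes from the
    diagonals. *)
Lemma circular_section : circular g.
Proof.
split=> i j k l f; last first.
  by exists 0, 0; rewrite !subr0; split; apply: unit_section_null.
apply: (coplanar_spanned (g i - g j) (g k - g j)).
- exact: (subvP (addvSl _ _) _ (memv_line _)).
- exact: (subvP (addvSr _ _) _ (memv_line _)).
have [[a0 b0 ab _] [ij jk ik jl _]] := holomorphic_face hphi f.
(* Distinct labels allow the diagonal formula to be solved for [g j - g l], a multiple of
   [x i - x k], which in turn is a sum of two edges in the plane. *)
have k0 : (m i l)^-1 - (m i j)^-1 != 0.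
  by rewrite subr_eq0 (inj_eq invr_inj).
have := surface_diagonal _ _ _ _ f; rewrite scalerA.
set c := _ * _ => e; have c0 : c != 0.
  by rewrite mulf_neq0 // oppr_eq0 invr_eq0 mink_g_neq0.
rewrite -opprB rpredN -[X in X \in _](scalerK c0) -e rpredZ //.
case/and5P: (f) => eij ejk _ _ _; rewrite -(subrK (x j) (x i)) -addrA.
rewrite (surface_edge _ _ eij) (surface_edge _ _ ejk) !scalerA -(opprB (g k)) rpredD //.
- by rewrite (subvP (addvSl _ _)) ?memvZ ?memv_line.
- by rewrite (subvP (addvSr _ _)) ?memvZ ?rpredN ?memv_line.
Qed.

Lemma circular_surface : circular x.
Proof.
split=> i j k l f; have [[a0 b0 ab mjk] [ij jk ik jl _]] := holomorphic_face hphi f;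
  case/and5P: (f) => eij ejk _ _ _.
(* The edges at [x j] and the diagonal to [x l] are multiples of differences of [g i], [g j], [g k],
   so these directions contain the face of [x]. *)
- pose U := (<[g i - g j]> + <[g k - g j]>)%VS.
  have gi : g i - g j \in U by apply: (subvP (addvSl _ _)); apply: memv_line.
  have gk : g k - g j \in U by apply: (subvP (addvSr _ _)); apply: memv_line.
  apply: (coplanar_spanned (g i - g j) (g k - g j)); rewrite -/U.
  + by rewrite (surface_edge _ _ eij) !memvZ.
  + by rewrite -opprB memvN (surface_edge _ _ ejk) !memvZ // -opprB memvN.
  rewrite -opprB memvN (surface_diagonal' _ _ _ _ f) !memvZ //.
  by rewrite -(subrK (g j) (g i)) -addrA memvD // -opprB memvN.
apply: (null_quad_cocyclic a0 b0 (unit_section_null _ mu (phi i))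
  (unit_section_null _ mu (phi j)) (unit_section_null _ mu (phi k))
  (mink_g_neq0 _ _ ij) (mink_g_neq0 _ _ jk) (mink_g_neq0 _ _ ik)).
- exact: surface_edge.
- by rewrite -mjk; apply: surface_edge.
- exact: surface_diagonal'.
Qed.

Lemma surface_christoffel_dual : christoffel_dual x g.
Proof.
split; [exact: surface_edge_parallel|exact: circular_surface|exact: circular_section|].
exact: surface_mixed_area.
Qed.

Lemma gauss_map_null i : null_direction (gauss_map phi i).
Proof.
by apply: null_direction_line; rewrite ?nullvec_neq0 // mink_nullvec !subrr; ring.
Qed.

Lemma surface_legendre : legendre (legendre_of x (gauss_map phi)).
Proof.
split=> [i|i j e].
  by exists (x i), (gauss_map phi i); split=> //; apply: gauss_map_null.
have := surface_edge _ _ e; rewrite scalerA.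
(* As [x i - x j = c *: (g i - g j)], this point equals [x j - c *: g j] and lies on both lines. *)
set c := _ * _ => h; exists (x i - c *: g i).
have gG k : g k \in gauss_map phi k.
  by rewrite /gauss_map -/(nullvec _ _) -(section_line R mu (phi k) (hw k)).2 memv_line.
split; rewrite /legendre_of /affine_subspace /=.
  by rewrite addrAC subrr add0r rpredN memvZ.
by rewrite addrAC h scalerBr addrAC subrr add0r rpredN memvZ.
Qed.

(** Edges are multiples of [g i - g j], and both sections have product -1 with the normal. *)
Lemma surface_hyperplane i :
  mink (x i) (normal_vec mu) = mink (x (0, 0)) (normal_vec mu).
Proof.
apply: (grid_constant _ (fun i => mink (x i) (normal_vec mu))) => {}i j e.
apply/eqP; rewrite -subr_eq0 -(minkNl R) -minkDl (surface_edge _ _ e).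
by rewrite !minkZl minkDl minkNl !mink_unit_section_normal // subrr !mulr0.
Qed.

End WeierstrassSurface.

(** * Invariance under translation *)

Section Translation.
Variable R : realType.
Implicit Types (x y : Z2 -> vec R) (t q : vec R).

Lemma translateB x t i j : translate x t i - translate x t j = x i - x j.
Proof. by rewrite /translate opprD addrACA subrr addr0. Qed.

Lemma mixed_area_translate x y t q i j k l :
  mixed_area (translate x t) (translate y q) i j k l = mixed_area x y i j k l.
Proof. by rewrite /mixed_area !translateB. Qed.

Lemma circular_translate x t : circular x -> circular (translate x t).
Proof.
have E u v : u + t - (v + t) = u - v by rewrite opprD addrACA subrr addr0.
case=> hp hc; split=> i j k l f.
  have [q [U [dU h]]] := hp _ _ _ _ f; exists (q + t), U; split=> //.
  by move: h; rewrite /affine_subspace /translate /= !E.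
have [c [r h]] := hc _ _ _ _ f; exists (c + t), r.
by rewrite /translate !E.
Qed.

(** For [H = 0] the curvature equation is the vanishing mixed area of duality. Both surfaces are
    shifted: [x] to reach the required hyperplane, [y] because the Gauss maps are [gn] plus or minus
    [p]. *)
Lemma zero_mean_curvature_translate x y t q :
  christoffel_dual x y -> nondegenerate_area x ->
  zero_mean_curvature (translate x t) (translate y q).
Proof.
case=> par cx _ area nd; split=> [||i j e|i j k l f].
- exact: circular_translate.
- by move=> i j k l f; rewrite mixed_area_translate; apply: nd.
- by rewrite !translateB; apply: par.
- by rewrite mixed_area_translate area // scale0r addr0.
Qed.

End Translation.

(** * The three space forms *)

Theorem theorem4p1 (R : realType) (phi : Z2 -> R[i]) (m : Z2 -> Z2 -> R) (mu : R)
    (hphi : discrete_holomorphic phi m)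
    (hmu : mu = 1 \/ mu = -1 \/ mu = 0)
    (hnz : forall i : Z2, 1 + mu%:C * `|phi i| ^+ 2 != 0) :
  let p : 'rV[R]_4 := normal_vec mu in
  let G : Z2 -> {vspace 'rV[R]_4} := gauss_map phi in
  (* G takes values in the projective light cone, and g^n is well defined *)
  (forall i : Z2, null_direction (G i)) /\
  (exists gn : Z2 -> 'rV[R]_4,
    section_of_directions G gn /\ (forall i : Z2, mink (gn i) p = -1)) /\
  (forall g g' : Z2 -> 'rV[R]_4,
    section_of_directions G g -> (forall i : Z2, mink (g i) p = -1) ->
    section_of_directions G g' -> (forall i : Z2, mink (g' i) p = -1) ->
    forall i : Z2, g i = g' i) /\
  (* integrability, and uniqueness up to translation *)
  (exists x : Z2 -> 'rV[R]_4, weierstrass_surface mu phi m x) /\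
  (forall x y : Z2 -> 'rV[R]_4,
    weierstrass_surface mu phi m x -> weierstrass_surface mu phi m y ->
    exists t : 'rV[R]_4, forall i : Z2, y i = x i + t) /\
  (forall x gn : Z2 -> 'rV[R]_4,
    weierstrass_surface mu phi m x ->
    section_of_directions G gn -> (forall i : Z2, mink (gn i) p = -1) ->
    (exists c : R, forall i : Z2, mink (x i) p = c) /\
    legendre (legendre_of x G) /\
    Omega_dual (legendre_of x G) G /\
    christoffel_dual x gn /\
    (* the standing assumption when curvatures are considered *)
    (nondegenerate_area x ->
      (mu = 1 -> exists t : 'rV[R]_4,
        minimal_surface (ee 0) (translate x t) (fun i => gn i - p)) /\
      (mu = -1 -> exists t : 'rV[R]_4,
        maximal_surface (ee 3) (translate x t) (fun i => gn i + p)) /\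
      (mu = 0 -> forall o : 'rV[R]_4, mink o o = 0 -> mink o p = -1 ->
        exists t : 'rV[R]_4, i_minimal_surface p o (translate x t) G gn))).
Proof.
have hw i : weight R mu (phi i) != 0 by rewrite -weight_neq0.
move=> p G; split; first by move=> i; apply: gauss_map_null.
split.
  exists (fun i => unit_section R mu (phi i)); split=> i.
    exact: section_line.
  exact: mink_unit_section_normal.
have unique gn : section_of_directions G gn -> (forall i, mink (gn i) p = -1) ->
    gn = fun i => unit_section R mu (phi i).
  move=> hG hp; apply: boolp.funext => i.
  by have [_ hi] := hG i; exact: (section_unique R mu _ _ hi (hp i) (hw i)).
split.
  by move=> g g' hg gp hg' gp' i; rewrite (unique _ hg gp) (unique _ hg' gp').
split; first exact: weierstrass_exists.
split; first exact: weierstrass_unique.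
move=> x gn hx hG hp; have gnE := unique _ hG hp.
have hplane i : mink (x i) p = mink (x (0, 0)) p.
  exact: (surface_hyperplane _ _ _ _ hphi hw x hx).
have hleg := surface_legendre _ _ _ _ hphi hw x hx.
have hdual : christoffel_dual x gn.
  by rewrite gnE; exact: (surface_christoffel_dual _ _ _ _ hphi hw x hx).
split; first by exists (mink (x (0, 0)) p).
split=> //; split; last split=> //.
  split=> //; first by split; [move=> i; apply: gauss_map_null|exists x].
  exists x, gn; split=> // i.
  by rewrite /legendre_of /affine_subspace /= subrr mem0v.
move=> hnd; set c := mink (x (0, 0)) p in hplane.
have gnull i : mink (gn i) (gn i) = 0 by rewrite gnE unit_section_null.
have curv t q := zero_mean_curvature_translate R x gn t q hdual hnd.
split=> [mu1|]; last split=> [mu1|mu0 o oo op].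
- have pE : p = ee 0.
    rewrite /p mu1 /normal_vec subrr mulr0 scale0r addr0.
    by rewrite (_ : 2^-1 * (1 + 1) = 1) ?scale1r //; field.
  have pp : mink p p = -1 by rewrite pE /mink !mxE /=; ring.
  (* Here [(p, p) = -1], so adding [c *: p] cancels the height [c]; in the Lorentzian case
     [(p, p) = 1] and the sign flips. *)
  clearbody p; exists (c *: p); rewrite -pE; split=> //.
  split=> [i|i|i|]; last exact: curv.
  + by rewrite /translate minkDl minkZl pp hplane; ring.
  + by rewrite minkDl minkNl pp hp; ring.
  + by rewrite !(minkDl, minkDr, minkNl, minkNr) pp gnull (minkC R p) hp; ring.
- have pE : p = ee 3.
    rewrite /p mu1 /normal_vec subrr mulr0 scale0r add0r.
    by rewrite (_ : 2^-1 * (1 - - 1) = 1) ?scale1r //; field.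
  have pp : mink p p = 1 by rewrite pE /mink !mxE /=; ring.
  clearbody p; exists (- c *: p); rewrite -pE; split=> //.
  split=> [i|i|i|]; last exact: curv.
  + by rewrite /translate minkDl minkZl pp hplane; ring.
  + by rewrite minkDl pp hp; ring.
  + by rewrite !(minkDl, minkDr) pp gnull (minkC R p) hp; ring.
have pp : mink p p = 0.
  by rewrite /p mu0 /mink !mxE /=; ring.
(* A null [p] cannot change the height, so the shift is along [o]. The isotropic space has height
   -1, and [(o, p) = -1] makes the coefficient [c + 1]. *)
clearbody p; exists ((c + 1) *: o); split=> //; split=> [i|||i|] //.
- by rewrite /translate !(minkDl, minkNl, minkZl) op hplane; ring.
(* The translate solves the same edge equations. *)
- apply: (surface_legendre _ _ _ _ hphi hw) => i j e.
  by rewrite translateB hx.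
- by rewrite minkDl minkNl op hp; ring.
by rewrite [X in zero_mean_curvature _ X](_ : gn = translate gn 0) //;
  apply: boolp.funext => i; rewrite /translate addr0.
Qed.
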